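(* Let $a\in\mathbb R$, $\lambda>0$, $\varepsilon>0$, $T>0$. Let $\mathbf U=(u,v)^\top$ be a smooth solution on $[0,T]\times\mathbb R$ of the Jin-Xin system $$\partial_t u+\partial_x v=0,\qquad \partial_t v+\lambda^2\partial_x u=\frac1\varepsilon(au-v),$$ and let $\bar u$ be a smooth solution on $[0,T]\times\mathbb R$ of $\partial_t\bar u+a\,\partial_x\bar u=0$. Set $\bar v=a\bar u$ and $\bar{\mathbf U}=(\bar u,\bar v)^\top$. Assume that: (i) $|a|<\lambda$; (ii) there are constant states $\mathbf U_-,\mathbf U_+\in\mathcal M_{\mathrm{eq}}$ such that for every $t\in[0,T]$, $$\lim_{x\to-\infty}\mathbf U(t,x)=\lim_{x\to-\infty}\bar{\mathbf U}(t,x)=\mathbf U_-,\qquad \lim_{x\to+\infty}\mathbf U(t,x)=\lim_{x\to+\infty}\bar{\mathbf U}(t,x)=\mathbf U_+;$$ (iii) there exists $K>0$ such that $\int_0^t\int_{\mathbb R}|\partial_x\bar u(s,x)|^2\,dx\,ds\le K^2$ for all $t\in[0,T]$. Then, for every $t\in[0,T]$, $$\Phi(t)+\frac1{2\varepsilon}\int_0^t\int_{\mathbb R}\bigl[a(u-\bar u)-(v-\bar v)\bigr]^2\,dx\,ds\le \Phi(0)+\frac{\varepsilon(\lambda^2-a^2)^2}{2}\int_0^t\int_{\mathbb R}|\partial_x\bar u(s,x)|^2\,dx\,ds.$$ In particular, $$\Phi(t)\le\Phi(0)+\frac{\varepsilon(\lambda^2-a^2)^2}{2}K^2 .$$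
   Context: The equilibrium manifold is $\mathcal M_{\mathrm{eq}}=\{(\bar u,\bar v)\in\mathbb R^2:\bar v=a\bar u\}$. Put $H=\begin{pmatrix}\lambda^2&-a\\-a&1\end{pmatrix}$ and $\eta(\mathbf U)=\frac12\mathbf U^\top H\mathbf U$. The relative entropy is $$\eta_{\mathrm{rel}}(\mathbf U\mid\bar{\mathbf U})=\eta(\mathbf U)-\eta(\bar{\mathbf U})-\nabla\eta(\bar{\mathbf U})\cdot(\mathbf U-\bar{\mathbf U})=\tfrac12(\mathbf U-\bar{\mathbf U})^\top H(\mathbf U-\bar{\mathbf U}),$$ and the relative entropy functional is $\Phi(t)=\int_{\mathbb R}\eta_{\mathrm{rel}}(\mathbf U(t,x)\mid\bar{\mathbf U}(t,x))\,dx$. *)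

(* Defs.v *)
From HB Require Import structures.
From mathcomp Require Import all_boot all_order all_algebra.
From mathcomp Require Import all_classical all_reals all_analysis.
Set Implicit Arguments.
Unset Strict Implicit.
Unset Printing Implicit Defensive.
Import Order.TTheory GRing.Theory Num.Theory.
Import numFieldNormedType.Exports.

Local Open Scope classical_set_scope.
Local Open Scope ring_scope.

Definition vec2 (R : realType) (x y : R) : 'cV[R]_2 :=
  \col_(i < 2) (if i == 0 then x else y).

Definition Meq (R : realType) (a : R) : set 'cV[R]_2 :=
  [set U | U 1 0 = a * U 0 0].

Definition Hmx (R : realType) (a lambda : R) : 'M[R]_2 :=
  \matrix_(i < 2, j < 2)
    (if i == j then (if i == 0 then lambda ^+ 2 else 1) else - a).

Definition eta (R : realType) (a lambda : R) (U : 'cV[R]_2) : R :=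
  2^-1 * (U^T *m Hmx a lambda *m U) 0 0.

Definition grad (R : realType) (f : 'cV[R]_2 -> R) (U : 'cV[R]_2) : 'cV[R]_2 :=
  \col_(i < 2) 'D_(delta_mx i 0) f U.

Definition eta_rel (R : realType) (a lambda : R) (U Ub : 'cV[R]_2) : R :=
  eta a lambda U - eta a lambda Ub
  - ((grad (eta a lambda) Ub)^T *m (U - Ub)) 0 0.

(* Functions of (t, x) are only relevant on the strip [0, T] x R, so the time
   derivative is the limit of difference quotients along [0, T]: it is
   two-sided for 0 < t < T and one-sided at t = 0 and t = T. *)
Definition dt_filter (R : realType) (T t : R) (f : R -> R -> R) (x : R) :
    set_system R :=
  (fun s : R => (s - t)^-1 * (f s x - f t x)) @ within `[0, T] t^'.

Definition dt (R : realType) (T : R) (f : R -> R -> R) (t x : R) : R :=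
  lim (dt_filter T t f x).

Definition dx (R : realType) (f : R -> R -> R) (t x : R) : R :=
  (f t)^`()%classic x.

Fixpoint Ck_strip (R : realType) (T : R) (k : nat) (f : R -> R -> R) : Prop :=
  {within `[0, T] `*` [set: R], continuous (fun p : R * R => f p.1 p.2)} /\
  match k with
  | 0%N => True
  | k'.+1 =>
      [/\ (forall t x, t \in `[0, T] -> cvg (dt_filter T t f x)),
          (forall t x, t \in `[0, T] -> derivable (f t) x 1),
          Ck_strip T k' (dt T f)
        & Ck_strip T k' (dx f)]
  end.

Definition smooth_strip (R : realType) (T : R) (f : R -> R -> R) : Prop :=
  forall k, Ck_strip T k f.

Definition jin_xin_solution (R : realType) (a lambda eps T : R)
    (u v : R -> R -> R) : Prop :=
  [/\ smooth_strip T u, smooth_strip T v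
    & forall t x, t \in `[0, T] ->
        dt T u t x + dx v t x = 0 /\
        dt T v t x + lambda ^+ 2 * dx u t x = eps^-1 * (a * u t x - v t x)].

Definition advection_solution (R : realType) (a T : R)
    (ub : R -> R -> R) : Prop :=
  smooth_strip T ub /\
  forall t x, t \in `[0, T] -> dt T ub t x + a * dx ub t x = 0.

(* Both integrals below are extended-real Lebesgue integrals; their integrands
   are nonnegative (for eta_rel, when |a| <= lambda), so the value +oo is
   meaningful. *)
Definition Phi (R : realType) (a lambda : R) (U Ub : R -> R -> 'cV[R]_2)
    (t : R) : \bar R :=
  (\int[lebesgue_measure]_x (eta_rel a lambda (U t x) (Ub t x))%:E)%E.

Definition space_time_int (R : realType) (t : R) (f : R -> R -> R) : \bar R :=
  (\int[lebesgue_measure]_(s in `[0%R, t]) \int[lebesgue_measure]_x (f s x)%:E)%E.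

(* Main.v *)
Require Import Defs.
From HB Require Import structures.
From mathcomp Require Import all_boot all_order all_algebra.
From mathcomp Require Import all_classical all_reals all_analysis.
From mathcomp Require Import measurable_realfun ring lra.
Set Implicit Arguments.
Unset Strict Implicit.
Unset Printing Implicit Defensive.
Import Order.TTheory GRing.Theory Num.Theory.
Import numFieldNormedType.Exports.

Local Open Scope classical_set_scope.
Local Open Scope ring_scope.

(** The argument is an entropy estimate localized in a backward cone of
    dependence, followed by exhaustion of the line by such cones.

    Write [p = u - ub] and [q = v - vb].  The relative entropy is the quadratic
    form [quad_entropy p q = (lambda^2 p^2 - 2 a p q + q^2) / 2] ([eta_relE]).
    Subtracting the two systems gives [p_t + q_x = 0] and
    [q_t + lambda^2 p_x = (a p - q) / eps - (lambda^2 - a^2) ub_x], whence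
      [d_t quad_entropy + d_x quad_flux
         = - z^2 / eps + (lambda^2 - a^2) z ub_x],   with [z = a p - q],
    and Young's inequality bounds the right-hand side by
    [- z^2 / (2 eps) + eps (lambda^2 - a^2)^2 / 2 * ub_x^2]
    ([quad_entropy_balance_le]).

    The characteristic speeds are [lambda] and [- lambda], and accordingly
    [`|quad_flux| <= lambda * quad_entropy] ([quad_flux_le]).  This domination
    makes decay at infinity of the flux superfluous.  Multiply the balance by
    [cutoff N s x = max (0, 1 - (x / N)^2 - 2 lambda s / N)^2].  It is C^1, and
    for [s >= 0] it vanishes when [`|x| >= N], and the terms in which it is
    differentiated have a nonpositive sum, because its support shrinks faster
    than the entropy can travel ([cutoff_flux_le0]).  Integrating over
    the box [0, t] x [-N, N], by Fubini's theorem and the fundamental theorem of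
    calculus in each variable ([box_balance_le]), gives the weighted inequality.
    As [N] grows the cutoffs increase to 1, and monotone convergence yields the
    estimate on the whole line ([finite_speed_integral_le]), as an inequality
    between possibly infinite integrals.

    Functions given on the strip [0, T] x R are extended to the plane by
    freezing them in time outside [0, T] ([clamp]); the extensions of a function
    and of its derivatives are continuous on the plane, so that all
    measurability questions reduce to that of continuous functions. *)

(** * Continuous functions of two real variables and integrals over boxes *)

(** An open subset of the plane is the union of the rational squares that it
    contains. *)
Lemma open_measurable2 (R : realType) (U : set (R * R)) :
  open U -> measurable (U : set (measurableTypeR R * measurableTypeR R)).
Proof.
move=> oU.
pose box (q : rat * rat * rat) : set (R * R) :=
  ball (ratr q.1.1 : R) (ratr q.2) `*` ball (ratr q.1.2 : R) (ratr q.2).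
pose F (q : rat * rat * rat) := if `[< box q `<=` U >] then box q else set0.
have -> : U = \bigcup_q F q.
  apply/seteqP; split=> [[x y] Uxy|[x y] [q _]]; last first.
    by rewrite /F; case: asboolP => // qU /qU.
  have := open_nbhs_nbhs (conj oU Uxy).
  rewrite -nbhs_ballE => -[e /= e0 eU].
  have e20 : 0 < e / 2 by rewrite divr_gt0.
  have [r] := rat_in_itvoo e20; rewrite in_itv/= => /andP[r0 re].
  have xr : x - ratr r < x + ratr r by rewrite ltrBlDr -addrA ltrDl addr_gt0.
  have yr : y - ratr r < y + ratr r by rewrite ltrBlDr -addrA ltrDl addr_gt0.
  have [a] := rat_in_itvoo xr; rewrite in_itv/= => /andP[xa1 xa2].
  have [b] := rat_in_itvoo yr; rewrite in_itv/= => /andP[yb1 yb2].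
  have xa : ball (ratr a : R) (ratr r) x.
    by rewrite /ball/= ltr_distlC; apply/andP; split; lra.
  have yb : ball (ratr b : R) (ratr r) y.
    by rewrite /ball/= ltr_distlC; apply/andP; split; lra.
  exists (a, b, r) => //; rewrite /F; case: asboolP => [_//|[]].
  move=> [x' y'] [/= xa' yb']; apply: eU; split => /=.
    apply: (@le_ball _ _ _ (ratr r + ratr r)); first by lra.
    exact: (ball_triangle (ball_sym xa) xa').
  apply: (@le_ball _ _ _ (ratr r + ratr r)); first by lra.
  exact: (ball_triangle (ball_sym yb) yb').
apply: countable_bigcupT_measurable => [|q]; first exact: countableP.
rewrite /F; case: asboolP => _; last exact: measurable0.
by apply: measurableX; exact: measurable_ball.
Qed.

Lemma continuous_measurable2 (R : realType) (f : R * R -> R) :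
  continuous f ->
  measurable_fun [set: measurableTypeR R * measurableTypeR R] f.
Proof.
move=> /continuousP cf; apply: (measurability _ (RGenOpens.measurableE R)).
move=> _ [_ [a [b ->] <-]]; rewrite setTI; apply: open_measurable2.
exact/cf/interval_open.
Qed.

Lemma box_integrable (R : realType) (a b c d : R) (f : R * R -> R) :
  continuous f ->
  (@lebesgue_measure R \x @lebesgue_measure R)%E.-integrable
    (`[a, b] `*` `[c, d]) (EFin \o f).
Proof.
move=> cf; apply: measurable_bounded_integrable.
- by apply: measurableX.
- rewrite /= product_measure1E//= !lebesgue_measure_itv/=.
  by do 2 case: ifP => _; rewrite ?mul0e ?mule0 -?EFinB -?EFinM ?ltry.
- by apply: measurable_funS (continuous_measurable2 cf).
- have cK : compact (f @` (`[a, b] `*` `[c, d])).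
    apply: continuous_compact.
      exact: continuous_subspaceT.
    by apply: compact_setX; exact: segment_compact.
  have [M [Mr HM]] := compact_bounded cK.
  exists M; split => // x /HM Hx z Az; apply: Hx.
  by exists z.
Qed.

Lemma box_fubini1 (R : realType) (a b c d : R) (f : R * R -> R) :
  continuous f ->
  (\int[@lebesgue_measure R \x @lebesgue_measure R]_(z in `[a, b] `*` `[c, d])
     (f z)%:E =
   \int[lebesgue_measure]_(s in `[a, b])
     \int[lebesgue_measure]_(x in `[c, d]) (f (s, x))%:E)%E.
Proof.
move=> cf; have := box_integrable a b c d cf.
rewrite (integrable_mkcond _ _)/=; last exact: measurableX.
move=> /integral12_prod_meas1 H; rewrite integral_mkcond -H.
rewrite [RHS]integral_mkcond; apply: eq_integral => s _.
rewrite /fubini_F patchE; case: ifPn => sab.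
  rewrite [RHS]integral_mkcond; apply: eq_integral => x _.
  by rewrite !patchE in_setX /= sab.
by apply: integral0_eq => x _; rewrite patchE in_setX/= (negbTE sab).
Qed.

Lemma box_fubini2 (R : realType) (a b c d : R) (f : R * R -> R) :
  continuous f ->
  (\int[@lebesgue_measure R \x @lebesgue_measure R]_(z in `[a, b] `*` `[c, d])
     (f z)%:E =
   \int[lebesgue_measure]_(x in `[c, d])
     \int[lebesgue_measure]_(s in `[a, b]) (f (s, x))%:E)%E.
Proof.
move=> cf; have := box_integrable a b c d cf.
rewrite (integrable_mkcond _ _)/=; last exact: measurableX.
move=> /integral21_prod_meas1 H; rewrite integral_mkcond -H.
rewrite [RHS]integral_mkcond; apply: eq_integral => x _.
rewrite /fubini_G patchE; case: ifPn => xcd.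
  rewrite [RHS]integral_mkcond; apply: eq_integral => s _.
  by rewrite !patchE in_setX /= xcd andbT.
by apply: integral0_eq => s _; rewrite patchE in_setX/= (negbTE xcd) andbF.
Qed.

Lemma continuous_slice1 (R : realType) (f : R -> R -> R) (x : R) :
  continuous (fun z : R * R => f z.1 z.2) -> continuous (f^~ x).
Proof.
move=> cf s; apply: (@continuous_comp _ _ _ (fun s => (s, x))
  (fun z : R * R => f z.1 z.2)); last exact: cf.
by apply: (cvg_pair (G := nbhs s) (H := nbhs x)); [exact: cvg_id|exact: cvg_cst].
Qed.

Lemma continuous_slice2 (R : realType) (f : R -> R -> R) (s : R) :
  continuous (fun z : R * R => f z.1 z.2) -> continuous (f s).
Proof.
move=> cf x; apply: (@continuous_comp _ _ _ (fun x => (s, x))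
  (fun z : R * R => f z.1 z.2)); last exact: cf.
by apply: (cvg_pair (G := nbhs s) (H := nbhs x)); [exact: cvg_cst|exact: cvg_id].
Qed.

Lemma continuous_itv_integrable (R : realType) (a b : R) (f : R -> R) :
  continuous f -> lebesgue_measure.-integrable `[a, b] (EFin \o f).
Proof.
move=> cf; apply: continuous_compact_integrable; first exact: segment_compact.
exact: continuous_subspaceT.
Qed.

Lemma FTC2_continuous (R : realType) (a b : R) (F f : R -> R) :
  a < b -> continuous F -> continuous f ->
  (forall x : R, x \in `]a, b[ -> is_derive x 1 F (f x)) ->
  (\int[lebesgue_measure]_(x in `[a, b]) (f x)%:E = (F b - F a)%:E)%E.
Proof.
move=> ab cF cf dF; rewrite (continuous_FTC2 ab _ _ _ (F := F)) ?EFinB//.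
- exact: continuous_subspaceT.
- split.
  + by move=> x /dF [].
  + by apply: cvg_at_right_filter; exact: cF.
  + by apply: cvg_at_left_filter; exact: cF.
- by move=> x /dF dFx; rewrite derive1E derive_val.
Qed.

(** Integrated form, over the box [0, t] x [-L, L], of a differential inequality
    [d_t A + d_x B + D <= S] whose flux [B] vanishes on the lateral sides. *)
Lemma box_balance_le (R : realType) (t L : R) (A a B b D S : R -> R -> R) :
  0 < t -> 0 < L ->
  continuous (fun z : R * R => A z.1 z.2) ->
  continuous (fun z : R * R => a z.1 z.2) ->
  continuous (fun z : R * R => b z.1 z.2) ->
  continuous (fun z : R * R => D z.1 z.2) ->
  continuous (fun z : R * R => S z.1 z.2) ->
  (forall s x : R, s \in `]0, t[ -> is_derive s 1 (A^~ x) (a s x)) ->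
  (forall s x : R, s \in `[0, t] -> is_derive x 1 (B s) (b s x)) ->
  (forall s : R, s \in `[0, t] -> B s (- L) = 0 /\ B s L = 0) ->
  (forall s x : R, s \in `[0, t] -> x \in `[- L, L] ->
    a s x + b s x + D s x <= S s x) ->
  (\int[lebesgue_measure]_(x in `[(- L)%R, L]) (A t x)%:E
   + \int[lebesgue_measure]_(s in `[0%R, t])
       \int[lebesgue_measure]_(x in `[(- L)%R, L]) (D s x)%:E
   <= \int[lebesgue_measure]_(x in `[(- L)%R, L]) (A 0%R x)%:E
   + \int[lebesgue_measure]_(s in `[0%R, t])
       \int[lebesgue_measure]_(x in `[(- L)%R, L]) (S s x)%:E)%E.
Proof.
move=> t0 L0 cA ca cb cD cS dA dB B0 le_S.
have LL : - L < L by lra.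
have mbox : measurable (`[0, t] `*` `[(- L)%R, L] :
    set (measurableTypeR R * measurableTypeR R)) by exact: measurableX.
have ibox f (cf : continuous (fun z : R * R => f z.1 z.2)) :=
  box_integrable 0 t (- L) L cf.
have intA s : (\int[lebesgue_measure]_(x in `[(- L)%R, L]) (A s x)%:E)%E \is a fin_num.
  by apply: integrable_fin_num => //; apply: continuous_itv_integrable;
     exact: continuous_slice2.
have Pa := box_fubini2 0 t (- L) L ca.
have Pb := box_fubini1 0 t (- L) L cb.
have PD := box_fubini1 0 t (- L) L cD.
have PS := box_fubini1 0 t (- L) L cS.
rewrite -PD -PS.
have {}Pb : (\int[@lebesgue_measure R \x @lebesgue_measure R]_(z in
    `[0%R, t] `*` `[(- L)%R, L]) (b z.1 z.2)%:E = 0)%E.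
  rewrite Pb; apply: integral0_eq => s /= st.
  have st' : s \in `[0, t] by [].
  have [BL BR] := B0 _ st'.
  have E : (\int[lebesgue_measure]_(x in `[(- L)%R, L]) (b s x)%:E = (B s L - B s (- L))%:E)%E.
    have cBs : continuous (B s).
      move=> x; have [dBx _] := dB s x st'.
      by apply: differentiable_continuous; apply/derivable1_diffP.
    have cbs : continuous (b s) by exact: continuous_slice2.
    exact: (FTC2_continuous LL cBs cbs (fun x _ => dB s x st')).
  by rewrite BL BR subrr in E.
have {}Pa : (\int[@lebesgue_measure R \x @lebesgue_measure R]_(z in
    `[0%R, t] `*` `[(- L)%R, L]) (a z.1 z.2)%:E =
  \int[lebesgue_measure]_(x in `[(- L)%R, L]) (A t x)%:E -
  \int[lebesgue_measure]_(x in `[(- L)%R, L]) (A 0%R x)%:E)%E.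
  have iA s : lebesgue_measure.-integrable `[(- L)%R, L] (EFin \o A s).
    by apply: continuous_itv_integrable; exact: continuous_slice2.
  rewrite Pa -(integralB_EFin _ (iA t) (iA 0)); last exact: measurable_itv.
  apply: eq_integral => x _.
  have cAx : continuous (A^~ x) by exact: continuous_slice1.
  have cax : continuous (a^~ x) by exact: continuous_slice1.
  exact: (FTC2_continuous t0 cAx cax (fun s st => dA s x st)).
have : (\int[@lebesgue_measure R \x @lebesgue_measure R]_(z in
    `[0%R, t] `*` `[(- L)%R, L]) (a z.1 z.2 + b z.1 z.2 + D z.1 z.2)%:E <=
  \int[@lebesgue_measure R \x @lebesgue_measure R]_(z in
    `[0%R, t] `*` `[(- L)%R, L]) (S z.1 z.2)%:E)%E.
  apply: le_integral => //.
  - apply: (box_integrable 0 t (- L) L (f := fun z => a z.1 z.2 + b z.1 z.2 + D z.1 z.2)).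
    by move=> z; apply: cvgD; [apply: cvgD; [exact: ca|exact: cb]|exact: cD].
  - exact: ibox.
  - move=> [s x]; rewrite in_setX => /andP[/set_mem/= st /set_mem/= xL].
    by rewrite lee_fin; exact: le_S.
rewrite (@integralD_EFin _ _ _ _ _ mbox (fun z => a z.1 z.2 + b z.1 z.2)
  (fun z => D z.1 z.2)); last 2 first.
  - apply: (box_integrable 0 t (- L) L (f := fun z => a z.1 z.2 + b z.1 z.2)).
    by move=> z; apply: cvgD; [exact: ca|exact: cb].
  - exact: ibox.
rewrite (@integralD_EFin _ _ _ _ _ mbox (fun z => a z.1 z.2)
  (fun z => b z.1 z.2)); [|exact: ibox|exact: ibox].
rewrite [X in (_ + X + _)%E](_ : _ = 0%E)// adde0.
rewrite [X in (X + _)%E](_ : _ = \int[lebesgue_measure]_(x in `[(- L)%R, L]) (A t x)%:E -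
  \int[lebesgue_measure]_(x in `[(- L)%R, L]) (A 0%R x)%:E)%E//.
by rewrite addeAC leeBlDr// addeC [in leRHS]addeC.
Qed.

(** * The cutoff function *)

(** The square of the positive part, a C^1 function. *)
Definition sqpos (R : realType) (y : R) : R := (Num.max y 0) ^+ 2.

Lemma is_derive_sqpos (R : realType) (y : R) :
  is_derive y 1 (@sqpos R) (2 * Num.max y 0).
Proof.
have [y0|y0|->] := ltgtP y 0.
- apply: (near_eq_is_derive (f := cst 0)).
    near=> z; rewrite /sqpos max_r ?expr0n//.
    by apply: ltW; near: z; exact: lt_nbhsl.
  by rewrite mulr0; exact: is_derive_cst.
- apply: (near_eq_is_derive (f := fun z : R => z ^+ 2 : R)).
    near=> z; rewrite /sqpos max_l//.
    by apply: ltW; near: z; exact: lt_nbhsr.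
  by apply: is_derive_eq; rewrite /GRing.scale/=; ring.
- rewrite mulr0.
  (* at 0 the difference quotient is [max h 0] *)
  have H : h^-1 *: (sqpos (h *: (1 : R) + 0) - sqpos (0 : R))
      @[h --> (0 : R)^'] --> (0 : R).
    apply: cvg_trans; first apply: (near_eq_cvg (f := fun h : R => Num.max h 0)).
      near=> h; rewrite /sqpos maxxx expr0n/= subr0 addr0 /GRing.scale/= mulr1.
      have h0 : h != 0 by near: h; exact: nbhs_dnbhs_neq.
      have [h1|h1] := leP 0 h; last by rewrite expr0n mulr0.
      by rewrite expr2 mulrA mulVf// mul1r.
    apply: cvg_within_filter.
    have : {for 0, continuous (fun h : R => Num.max h 0)}.
      apply: (@continuous_max R _ id (cst 0) 0); first exact: cvg_id.
      exact: cvg_cst.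
    by rewrite /prop_for /continuous_at maxxx.
  apply: DeriveDef; first by apply/cvg_ex; exists 0.
  by rewrite /derive; apply: cvg_lim.
Unshelve. all: by end_near. Qed.

Lemma continuous_sqpos (R : realType) : continuous (@sqpos R).
Proof.
move=> y; have [d _] := is_derive_sqpos y.
by apply: differentiable_continuous; apply/derivable1_diffP.
Qed.

Lemma sqpos_ge0 (R : realType) (y : R) : 0 <= sqpos y.
Proof. exact: sqr_ge0. Qed.

Lemma sqpos_le0 (R : realType) (y : R) : y <= 0 -> sqpos y = 0.
Proof. by move=> y0; rewrite /sqpos max_r// expr0n. Qed.

Lemma le_sqpos (R : realType) : {homo @sqpos R : y z / y <= z}.
Proof.
move=> y z yz; rewrite /sqpos ler_pXn2r//; last 2 first.
- by rewrite nnegrE le_max lexx orbT.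
- by rewrite nnegrE le_max lexx orbT.
by rewrite ge_max !le_max yz lexx orbT.
Qed.

(** The profile of the cutoff: if [N > 0] and [lam, s >= 0], it is at most 1,
    and positive only inside ]-N, N[.  The factor 2 in front of [lam] compensates
    [`|d_x (x / N)^2| <= 2 / N] on that interval. *)
Definition cone (R : realType) (lam N s x : R) : R :=
  1 - (x / N) ^+ 2 - 2 * lam * s / N.

(** The cutoff at scale [N] attached to the propagation speed [lam]. *)
Definition cutoff (R : realType) (lam N s x : R) : R := sqpos (cone lam N s x).

(** The derivative of [sqpos] at the value of the profile: the factor common to
    both partial derivatives of [cutoff]. *)
Definition cutoff_slope (R : realType) (lam N s x : R) : R :=
  2 * Num.max (cone lam N s x) 0.

Lemma is_derive_cutoff_t (R : realType) (lam N s x : R) :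
  is_derive s 1 ((cutoff lam N)^~ x)
    (cutoff_slope lam N s x * (- (2 * lam / N))).
Proof.
apply: (is_derive1_comp (is_derive_sqpos _)).
rewrite /cone; apply: is_derive_eq; rewrite /GRing.scale/=; ring.
Qed.

Lemma is_derive_cutoff_x (R : realType) (lam N s x : R) :
  is_derive x 1 (cutoff lam N s)
    (cutoff_slope lam N s x * (- (2 * x / N ^+ 2))).
Proof.
apply: (is_derive1_comp (is_derive_sqpos _)).
rewrite /cone; apply: is_derive_eq; rewrite /GRing.scale/= -exprVn; ring.
Qed.

Lemma cvg_sqr (R : realType) (T : Type) (F : set_system T) (FF : Filter F)
    (f : T -> R) (l : R) :
  f x @[x --> F] --> l -> f x ^+ 2 @[x --> F] --> l ^+ 2.
Proof. by move=> fl; rewrite expr2; apply: cvgM. Qed.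

Lemma continuous_cone (R : realType) (lam N : R) :
  continuous (fun z : R * R => cone lam N z.1 z.2).
Proof.
move=> z; apply: cvgB; first apply: cvgB; first exact: cvg_cst.
- by apply: cvg_sqr; apply: cvgM; [exact: cvg_snd|exact: cvg_cst].
- apply: cvgM; last exact: cvg_cst.
  by apply: cvgM; [exact: cvg_cst|exact: cvg_fst].
Qed.

Lemma continuous_cutoff (R : realType) (lam N : R) :
  continuous (fun z : R * R => cutoff lam N z.1 z.2).
Proof.
move=> z; apply: (@continuous_comp _ _ _ (fun z : R * R => cone lam N z.1 z.2) (@sqpos R)).
  exact: continuous_cone.
exact: continuous_sqpos.
Qed.

Lemma continuous_cutoff_slope (R : realType) (lam N : R) :
  continuous (fun z : R * R => cutoff_slope lam N z.1 z.2).
Proof.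
move=> z; apply: cvgM; first exact: cvg_cst.
apply: (@continuous_max R _ (fun z : R * R => cone lam N z.1 z.2) (cst 0) z).
  exact: continuous_cone.
exact: cvg_cst.
Qed.

Lemma cutoff_eq0 (R : realType) (lam N s x : R) :
  0 <= lam -> 0 < N -> 0 <= s -> N <= `|x| -> cutoff lam N s x = 0.
Proof.
move=> lam0 N0 s0 xN; apply: sqpos_le0.
have H1 : 1 <= (x / N) ^+ 2.
  rewrite -real_normK ?num_real// normf_div (gtr0_norm N0).
  by rewrite expr_ge1 ?divr_ge0 ?(ltW N0)// ler_pdivlMr// mul1r.
have H2 : 0 <= 2 * lam * s / N by rewrite !mulr_ge0// invr_ge0 ltW.
rewrite /cone; lra.
Qed.

Lemma cutoff_le1 (R : realType) (lam N s x : R) :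
  0 <= lam -> 0 < N -> 0 <= s -> cutoff lam N s x <= 1.
Proof.
move=> lam0 N0 s0.
have H1 : 0 <= (x / N) ^+ 2 by exact: sqr_ge0.
have H2 : 0 <= 2 * lam * s / N by rewrite !mulr_ge0// invr_ge0 ltW.
have -> : 1 = sqpos (1 : R) by rewrite /sqpos max_l// expr1n.
apply: le_sqpos; rewrite /cone; lra.
Qed.

Lemma le_cutoff (R : realType) (lam N M s x : R) :
  0 <= lam -> 0 < N -> N <= M -> 0 <= s ->
  cutoff lam N s x <= cutoff lam M s x.
Proof.
move=> lam0 N0 NM s0; apply: le_sqpos; rewrite /cone.
have M0 : 0 < M by exact: lt_le_trans NM.
have VMN : M^-1 <= N^-1 by rewrite lef_pV2.
have H1 : 2 * lam * s / M <= 2 * lam * s / N by rewrite ler_wpM2l// !mulr_ge0.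
have H2 : (x / M) ^+ 2 <= (x / N) ^+ 2.
  rewrite !exprMn ler_wpM2l ?sqr_ge0// ler_pXn2r// nnegrE invr_ge0 ltW//.
lra.
Qed.

Lemma cvg_cutoff (R : realType) (lam s x : R) :
  cutoff lam n.+1%:R s x @[n --> \oo] --> (1 : R).
Proof.
have V0 := @cvg_harmonic R.
have one : sqpos (1 - (x * 0) ^+ 2 - 2 * lam * s * 0 : R) = 1.
  by rewrite !mulr0 expr0n !subr0 /sqpos max_l// expr1n.
suff : cutoff lam n.+1%:R s x @[n --> \oo] -->
    sqpos (1 - (x * 0) ^+ 2 - 2 * lam * s * 0 : R) by rewrite one.
apply: continuous_cvg; first exact: continuous_sqpos.
apply: cvgB; first apply: cvgB; first exact: cvg_cst.
- by apply: cvg_sqr; apply: cvgM; [exact: cvg_cst|exact: V0].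
- by apply: cvgM; [exact: cvg_cst|exact: V0].
Qed.

(** The left-hand side collects the terms of [d_t (w e) + d_x (w F)], with
    [w = cutoff lam N], in which [w] is differentiated. *)
Lemma cutoff_flux_le0 (R : realType) (lam N s x e F : R) :
  0 < lam -> 0 < N -> 0 <= s -> `|F| <= lam * e ->
  cutoff_slope lam N s x * (- (2 * lam / N)) * e
    + cutoff_slope lam N s x * (- (2 * x / N ^+ 2)) * F <= 0.
Proof.
move=> lam0 N0 s0 Fe; rewrite /cutoff_slope.
have [c0|c0] := leP (cone lam N s x) 0; first by rewrite mulr0 !mul0r addr0.
have H2 : 0 <= 2 * lam * s / N.
  by rewrite !mulr_ge0// ?(ltW lam0)// invr_ge0 ltW.
(* a positive profile forces [`|x| <= N] *)
have xN : `|x / N| <= 1.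
  rewrite -(@ler_pXn2r _ 2)// ?nnegrE// real_normK ?num_real// expr1n.
  by move: c0; rewrite /cone; lra.
have FN : - (x / N * F) <= lam * e.
  apply: le_trans Fe; apply: le_trans (ler_norm _) _.
  by rewrite normrN normrM ler_piMl.
have -> : 2 * cone lam N s x * - (2 * lam / N) * e +
  2 * cone lam N s x * - (2 * x / N ^+ 2) * F =
  - (4 * cone lam N s x / N) * (lam * e + x / N * F).
  by rewrite -exprVn; ring.
rewrite mulNr oppr_le0 mulr_ge0//; last lra.
by rewrite divr_ge0 ?(ltW N0)// mulr_ge0// ltW.
Qed.

(** * Integrals against the cutoff *)

(** Monotone convergence towards a prescribed pointwise limit. *)
Lemma cvg_ge0_integral d (T : measurableType d) (R : realType)
    (mu : {measure set T -> \bar R}) (D : set T) (g : (T -> \bar R)^nat)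
    (f : T -> \bar R) :
  measurable D -> (forall n, measurable_fun D (g n)) ->
  (forall n x, D x -> (0 <= g n x)%E) ->
  (forall x, D x -> {homo g^~ x : n m / (n <= m)%N >-> (n <= m)%E}) ->
  (forall x, D x -> g n x @[n --> \oo] --> f x) ->
  (\int[mu]_(x in D) g n x)%E @[n --> \oo] --> (\int[mu]_(x in D) f x)%E.
Proof.
move=> mD mg g0 ndg gf.
have -> : (\int[mu]_(x in D) f x)%E =
    (\int[mu]_(x in D) (fun y => limn (g^~ y)) x)%E.
  by apply: eq_integral => x /set_mem Dx; apply/esym/cvg_lim => //; exact: gf.
exact: cvg_monotone_convergence.
Qed.

Section cutoff_integrals.
Context {R : realType} (lam : R) (f : R -> R -> R).
Hypotheses (lam0 : 0 <= lam) (f0 : forall s x, 0 <= f s x).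
Hypothesis cf : continuous (fun z : R * R => f z.1 z.2).

Let cwf N : continuous (fun z : R * R => cutoff lam N z.1 z.2 * f z.1 z.2).
Proof. by move=> z; apply: cvgM; [exact: continuous_cutoff|exact: cf]. Qed.

Let wf_ge0 N s x : 0 <= cutoff lam N s x * f s x.
Proof. by rewrite mulr_ge0// sqpos_ge0. Qed.

Let msec (g : R -> R -> R) s :
  continuous (fun z : R * R => g z.1 z.2) ->
  measurable_fun [set: measurableTypeR R] (fun x => (g s x)%:E).
Proof.
move=> cg; apply/measurable_EFinP; apply: continuous_measurable_fun.
exact: continuous_slice2.
Qed.

(** Measurability of the inner integral, part of Tonelli's theorem. *)
Lemma measurable_integral_slice (g : R -> R -> R) :
  continuous (fun z : R * R => g z.1 z.2) -> (forall s x, 0 <= g s x) ->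
  measurable_fun [set: measurableTypeR R] (fun s => \int[lebesgue_measure]_x (g s x)%:E)%E.
Proof.
move=> cg g0.
apply: (measurable_fun_fubini_tonelli_F (m2 := @lebesgue_measure R)
  (fun z => (g z.1 z.2)%:E)).
  by apply/measurable_EFinP; exact: (continuous_measurable2 cg).
by move=> z; rewrite lee_fin.
Qed.

Lemma integral_cutoff_box N s : 0 < N -> 0 <= s ->
  (\int[lebesgue_measure]_(x in `[(- N)%R, N]) (cutoff lam N s x * f s x)%:E
   = \int[lebesgue_measure]_x (cutoff lam N s x * f s x)%:E)%E.
Proof.
move=> N0 s0; rewrite integral_mkcond; apply: eq_integral => x _.
rewrite patchE; case: ifPn => // xN; rewrite cutoff_eq0 ?mul0r//.
rewrite leNgt; apply: contra xN => /ltW.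
by rewrite ler_norml => /andP[xl xr]; rewrite inE/= in_itv/= xl.
Qed.

Lemma le_integral_cutoff N s : 0 < N -> 0 <= s ->
  (\int[lebesgue_measure]_x (cutoff lam N s x * f s x)%:E
   <= \int[lebesgue_measure]_x (f s x)%:E)%E.
Proof.
move=> N0 s0; apply: ge0_le_integral => //.
- by move=> x _; rewrite lee_fin.
- exact: (@msec (fun s x => cutoff lam N s x * f s x) s (@cwf _)).
- exact: msec.
- by move=> x _; rewrite lee_fin ler_piMl// cutoff_le1.
Qed.

Lemma cvg_integral_cutoff s : 0 <= s ->
  (\int[lebesgue_measure]_x (cutoff lam n.+1%:R s x * f s x)%:E)%E
    @[n --> \oo] --> (\int[lebesgue_measure]_x (f s x)%:E)%E.
Proof.
move=> s0; apply: cvg_ge0_integral => //.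
- by move=> n; exact: (@msec (fun s x => cutoff lam n.+1%:R s x * f s x) s (@cwf _)).
- by move=> n x _; rewrite lee_fin.
- by move=> x _ n m nm; rewrite lee_fin ler_wpM2r// le_cutoff// ler_nat.
- move=> x _; apply: cvg_EFin; first exact: nearW.
  rewrite -[X in _ --> X]mul1r; apply: cvgM; last exact: cvg_cst.
  exact: cvg_cutoff.
Qed.

Lemma le_integral_cutoff2 N t : 0 < N ->
  (\int[lebesgue_measure]_(s in `[0%R, t]) \int[lebesgue_measure]_x
      (cutoff lam N s x * f s x)%:E
   <= \int[lebesgue_measure]_(s in `[0%R, t])
      \int[lebesgue_measure]_x (f s x)%:E)%E.
Proof.
move=> N0; apply: ge0_le_integral => //.
- by move=> s _; apply: integral_ge0 => x _; rewrite lee_fin.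
- apply: measurable_funTS.
  exact: (@measurable_integral_slice
    (fun s x => cutoff lam N s x * f s x) (@cwf _)).
- by apply: measurable_funTS; exact: measurable_integral_slice.
- by move=> s /=; rewrite in_itv/= => /andP[s0 _]; exact: le_integral_cutoff.
Qed.

Lemma cvg_integral_cutoff2 t :
  (\int[lebesgue_measure]_(s in `[0%R, t]) \int[lebesgue_measure]_x
      (cutoff lam n.+1%:R s x * f s x)%:E)%E @[n --> \oo] -->
  (\int[lebesgue_measure]_(s in `[0%R, t])
      \int[lebesgue_measure]_x (f s x)%:E)%E.
Proof.
apply: cvg_ge0_integral => //.
- move=> n; apply: measurable_funTS.
  exact: (@measurable_integral_slice
    (fun s x => cutoff lam n.+1%:R s x * f s x) (@cwf _)).
- by move=> n s _; apply: integral_ge0 => x _; rewrite lee_fin.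
- move=> s /=; rewrite in_itv/= => /andP[s0 _] n m nm.
  apply: ge0_le_integral => //.
  + by move=> x _; rewrite lee_fin.
  + exact: (@msec (fun s x => cutoff lam n.+1%:R s x * f s x) s (@cwf _)).
  + exact: (@msec (fun s x => cutoff lam m.+1%:R s x * f s x) s (@cwf _)).
  + by move=> x _; rewrite lee_fin ler_wpM2r// le_cutoff// ler_nat.
- by move=> s /=; rewrite in_itv/= => /andP[s0 _]; exact: cvg_integral_cutoff.
Qed.

Lemma integral2Zl (k t : R) : 0 <= k ->
  (\int[lebesgue_measure]_(s in `[0%R, t]) \int[lebesgue_measure]_x
      (k * f s x)%:E
   = k%:E * \int[lebesgue_measure]_(s in `[0%R, t])
      \int[lebesgue_measure]_x (f s x)%:E)%E.
Proof.
move=> k0; rewrite -ge0_integralZl//; last 2 first.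
- by apply: measurable_funTS; exact: measurable_integral_slice.
- by move=> s _; apply: integral_ge0 => x _; rewrite lee_fin.
apply: eq_integral => s _; rewrite -ge0_integralZl//.
- exact: msec.
- by move=> x _; rewrite lee_fin.
Qed.

End cutoff_integrals.

(** * Balance laws with finite speed of propagation *)

(** If [d_t e + d_x F + D <= S] with a flux dominated by the density,
    [`|F| <= lam * e], then the inequality may be integrated over the line: no
    flux comes in from infinity, whatever the behaviour of [e] there. *)
Lemma finite_speed_integral_le (R : realType) (lam t : R)
    (e et F Fx D S : R -> R -> R) :
  0 < lam -> 0 < t ->
  continuous (fun z : R * R => e z.1 z.2) ->
  continuous (fun z : R * R => et z.1 z.2) ->
  continuous (fun z : R * R => F z.1 z.2) ->
  continuous (fun z : R * R => Fx z.1 z.2) ->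
  continuous (fun z : R * R => D z.1 z.2) ->
  continuous (fun z : R * R => S z.1 z.2) ->
  (forall s x, 0 <= e s x) -> (forall s x, 0 <= D s x) ->
  (forall s x, 0 <= S s x) ->
  (forall s x : R, s \in `]0, t[ -> is_derive s 1 (e^~ x) (et s x)) ->
  (forall s x : R, s \in `[0, t] -> is_derive x 1 (F s) (Fx s x)) ->
  (forall s x : R, `|F s x| <= lam * e s x) ->
  (forall s x : R, s \in `[0, t] -> et s x + Fx s x + D s x <= S s x) ->
  (\int[lebesgue_measure]_x (e t x)%:E
   + \int[lebesgue_measure]_(s in `[0%R, t])
       \int[lebesgue_measure]_x (D s x)%:E
   <= \int[lebesgue_measure]_x (e 0%R x)%:E
   + \int[lebesgue_measure]_(s in `[0%R, t])
       \int[lebesgue_measure]_x (S s x)%:E)%E.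
Proof.
move=> lam0 t0 ce cet cF cFx cD cS e0 D0 S0 de dF Fe le_S.
have lam0' := ltW lam0.
pose w n := cutoff lam (n.+1%:R : R).
pose w' n := cutoff_slope lam (n.+1%:R : R).
have cw n : continuous (fun z : R * R => w n z.1 z.2) by exact: continuous_cutoff.
have cw' n : continuous (fun z : R * R => w' n z.1 z.2).
  exact: continuous_cutoff_slope.
have N0 n : 0 < n.+1%:R :> R by rewrite ltr0n.
have bound n :
  (\int[lebesgue_measure]_x (w n t x * e t x)%:E
   + \int[lebesgue_measure]_(s in `[0%R, t])
       \int[lebesgue_measure]_x (w n s x * D s x)%:E
   <= \int[lebesgue_measure]_x (e 0%R x)%:E
   + \int[lebesgue_measure]_(s in `[0%R, t])
       \int[lebesgue_measure]_x (S s x)%:E)%E.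
  pose a s x := w' n s x * (- (2 * lam / n.+1%:R)) * e s x + w n s x * et s x.
  pose b s x := w' n s x * (- (2 * x / n.+1%:R ^+ 2)) * F s x + w n s x * Fx s x.
  have cA : continuous (fun z : R * R => w n z.1 z.2 * e z.1 z.2).
    by move=> z; apply: cvgM; [exact: cw|exact: ce].
  have ca : continuous (fun z : R * R => a z.1 z.2).
    move=> z; apply: cvgD; last by apply: cvgM; [exact: cw|exact: cet].
    apply: cvgM; last exact: ce.
    by apply: cvgM; [exact: cw'|exact: cvg_cst].
  have cb : continuous (fun z : R * R => b z.1 z.2).
    move=> z; apply: cvgD; last by apply: cvgM; [exact: cw|exact: cFx].
    apply: cvgM; last exact: cF.
    apply: cvgM; first exact: cw'.
    apply: cvgN; apply: cvgM; last exact: cvg_cst.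
    by apply: cvgM; [exact: cvg_cst|exact: cvg_snd].
  have cwD : continuous (fun z : R * R => w n z.1 z.2 * D z.1 z.2).
    by move=> z; apply: cvgM; [exact: cw|exact: cD].
  have cwS : continuous (fun z : R * R => w n z.1 z.2 * S z.1 z.2).
    by move=> z; apply: cvgM; [exact: cw|exact: cS].
  have dA (s x : R) : s \in `]0, t[ ->
      is_derive s 1 (fun r => w n r x * e r x) (a s x).
    move=> st; have dw := is_derive_cutoff_t lam n.+1%:R s x.
    have dex := de s x st.
    by apply: is_derive_eq; rewrite /a /w /w' /GRing.scale/=; ring.
  have dB (s x : R) : s \in `[0, t] ->
      is_derive x 1 (fun y => w n s y * F s y) (b s x).
    move=> st; have dw := is_derive_cutoff_x lam n.+1%:R s x.
    have dFx := dF s x st.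
    by apply: is_derive_eq; rewrite /b /w /w' /GRing.scale/= -exprVn; ring.
  have B0 (s : R) : s \in `[0, t] ->
      w n s (- n.+1%:R) * F s (- n.+1%:R) = 0 /\ w n s n.+1%:R * F s n.+1%:R = 0.
    rewrite in_itv/= => /andP[s0 _].
    by rewrite /w !cutoff_eq0 ?mul0r// ?normrN ger0_norm.
  have le_ab (s x : R) : s \in `[0, t] -> x \in `[- n.+1%:R, n.+1%:R] ->
      a s x + b s x + w n s x * D s x <= w n s x * S s x.
    move=> st _; have s0 : 0 <= s by move: st; rewrite in_itv => /andP[].
    have H1 := cutoff_flux_le0 x lam0 (N0 n) s0 (Fe s x).
    have H2 : w n s x * (et s x + Fx s x + D s x) <= w n s x * S s x.
      by rewrite ler_wpM2l ?sqpos_ge0// le_S.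
    rewrite -[leRHS]add0r; apply: le_trans (lerD H1 H2).
    by rewrite le_eqVlt /a /b /w'; apply/orP; left; apply/eqP; ring.
  have := @box_balance_le R t n.+1%:R (fun s x => w n s x * e s x) a
    (fun s x => w n s x * F s x) b
    (fun s x => w n s x * D s x) (fun s x => w n s x * S s x) t0 (N0 n)
    cA ca cb cwD cwS dA dB B0 le_ab.
  have box1 s : 0 <= s ->
    (\int[lebesgue_measure]_(x in `[(- n.+1%:R)%R, n.+1%:R]) (w n s x * e s x)%:E =
     \int[lebesgue_measure]_x (w n s x * e s x)%:E)%E.
    exact: integral_cutoff_box.
  have box2 (f : R -> R -> R) (f0 : forall s x, 0 <= f s x) :
    (\int[lebesgue_measure]_(s in `[0%R, t])
       \int[lebesgue_measure]_(x in `[(- n.+1%:R)%R, n.+1%:R]) (w n s x * f s x)%:E =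
     \int[lebesgue_measure]_(s in `[0%R, t])
       \int[lebesgue_measure]_x (w n s x * f s x)%:E)%E.
    apply: eq_integral => s; rewrite inE/= in_itv/= => /andP[s0 _].
    exact: integral_cutoff_box.
  rewrite !box2// !box1 ?(ltW t0)// => /le_trans; apply.
  apply: leeD; first exact: (le_integral_cutoff _ e0).
  exact: (le_integral_cutoff2 _ S0).
have ct : (\int[lebesgue_measure]_x (w n t x * e t x)%:E
   + \int[lebesgue_measure]_(s in `[0%R, t])
       \int[lebesgue_measure]_x (w n s x * D s x)%:E)%E @[n --> \oo] -->
   (\int[lebesgue_measure]_x (e t x)%:E
   + \int[lebesgue_measure]_(s in `[0%R, t])
       \int[lebesgue_measure]_x (D s x)%:E)%E.
  apply: cvgeD.
  - apply: ge0_adde_def; rewrite inE; apply: integral_ge0 => s _.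
      by rewrite lee_fin.
    by apply: integral_ge0 => x _; rewrite lee_fin.
  - by apply: cvg_integral_cutoff => //; exact: ltW.
  - exact: cvg_integral_cutoff2.
(* the bound does not depend on n *)
rewrite -(cvg_lim _ ct)//; apply: lime_le.
  by apply/cvg_ex; eexists; exact: ct.
exact: nearW.
Qed.

(** * Extension of functions from the strip to the plane *)

(** The nearest point of [0, T]. *)
Definition clamp (R : realType) (T s : R) : R := Num.max 0 (Num.min s T).

Lemma clamp_itv (R : realType) (T s : R) : 0 <= T -> clamp T s \in `[0, T].
Proof.
move=> T0; rewrite in_itv/= /clamp le_max lexx/= ge_max T0/=.
by rewrite ge_min lexx orbT.
Qed.

Lemma clamp_id (R : realType) (T s : R) : s \in `[0, T] -> clamp T s = s.
Proof. by rewrite in_itv/= /clamp => /andP[s0 sT]; rewrite min_l// max_r. Qed.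

Lemma continuous_clamp (R : realType) (T : R) : continuous (clamp T).
Proof.
move=> s; apply: (@continuous_max R _ (cst 0) (fun s => Num.min s T)).
  exact: cvg_cst.
by apply: (@continuous_min R _ id (cst T)); [exact: cvg_id|exact: cvg_cst].
Qed.

Lemma continuous_clamp_ext (R : realType) (T : R) (f : R -> R -> R) :
  0 <= T ->
  {within `[0, T] `*` [set: R], continuous (fun z : R * R => f z.1 z.2)} ->
  continuous (fun z : R * R => f (clamp T z.1) z.2).
Proof.
move=> T0 /subspace_continuousP cf z.
pose h (y : R * R) := (clamp T y.1, y.2).
have hT y : (`[0, T] `*` [set: R]) (h y) by split => //; exact: clamp_itv.
apply: (@cvg_comp _ _ _ h (fun y : R * R => f y.1 y.2) _
  (within (`[0, T] `*` [set: R]) (nbhs (h z)))); last exact: (cf _ (hT z)).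
have ch : h y @[y --> z] --> h z.
  apply: (cvg_pair (G := nbhs (clamp T z.1)) (H := nbhs z.2)).
    by apply: continuous_cvg; [exact: continuous_clamp|exact: cvg_fst].
  exact: cvg_snd.
move=> A hA.
have {}hA : \forall y \near z, (`[0, T] `*` [set: R]) (h y) -> A (h y).
  exact: (ch _ hA).
by apply: (filterS _ hA) => y Ah; exact: (Ah (hT y)).
Qed.

(** At an interior time, [dt] is an ordinary derivative. *)
Lemma is_derive_clamp_ext (R : realType) (T s x : R) (f : R -> R -> R) :
  s \in `]0, T[ -> cvg (dt_filter T s f x) ->
  is_derive s 1 (fun r => f (clamp T r) x) (dt T f s x).
Proof.
rewrite in_itv/= => /andP[s0 sT] cf.
have cs : (h + s) @[h --> (0 : R)] --> s.
  have : {for 0, continuous (fun h : R => h + s)}.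
    by apply: cvgD; [exact: cvg_id|exact: cvg_cst].
  by rewrite /prop_for /continuous_at add0r.
have inT : \forall h \near (0 : R)^', 0 < h + s < T.
  by near=> h; apply/andP; split; near: h; apply: nbhs_dnbhs;
    [exact: (cs _ (lt_nbhsr s0))|exact: (cs _ (lt_nbhsl sT))].
have lim_s : h^-1 *: (f (clamp T (h *: (1 : R) + s)) x - f (clamp T s) x)
    @[h --> (0 : R)^'] --> dt T f s x.
  have H1 : (fun h : R => h + s) @ (0 : R)^' --> within `[0, T] s^'.
    move=> A HA.
    have sA : \forall r \near s, r != s -> `[0, T]%classic r -> A r by exact: HA.
    have {}sA : \forall h \near (0 : R)^',
        h + s != s -> `[0, T]%classic (h + s) -> A (h + s).
      by apply: nbhs_dnbhs; exact: (cs _ sA).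
    suff : \forall h \near (0 : R)^', A (h + s) by [].
    apply: filterS3 (nbhs_dnbhs_neq (0 : R)) inT sA.
    move=> h h0 /andP[h1 h2]; apply; last by rewrite /= in_itv/= !ltW.
    by rewrite -subr_eq0 addrK.
  have H2 := cvg_comp _ _ H1 cf.
  apply: cvg_trans H2; apply: near_eq_cvg.
  near=> h; have /andP[h1 h2] : 0 < h + s < T by near: h.
  by rewrite /= addrK /GRing.scale/= mulr1 !clamp_id// in_itv/= !ltW.
apply: DeriveDef; first by apply/cvg_ex; exists (dt T f s x).
by rewrite /derive; apply: cvg_lim.
Unshelve. all: by end_near. Qed.

(** What first-order smoothness on the strip gives for the extension in time:
    the function and its two partial derivatives are continuous on the plane. *)
Lemma C1_strip (R : realType) (T : R) (f : R -> R -> R) : 0 <= T ->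
  smooth_strip T f ->
  [/\ continuous (fun z : R * R => f (clamp T z.1) z.2),
      continuous (fun z : R * R => dt T f (clamp T z.1) z.2),
      continuous (fun z : R * R => dx f (clamp T z.1) z.2),
      (forall s x : R, s \in `]0, T[ ->
         is_derive s 1 (fun r => f (clamp T r) x) (dt T f (clamp T s) x)) &
      (forall s x : R,
         is_derive x 1 (f (clamp T s)) (dx f (clamp T s) x))].
Proof.
move=> T0 /(_ 1%N) /= [cf [ct cx [cdt _] [cdx _]]]; split.
- exact: continuous_clamp_ext.
- exact: continuous_clamp_ext.
- exact: continuous_clamp_ext.
- move=> s x sT; have sT' : s \in `[0, T] by exact: subset_itv_oo_cc.
  rewrite (clamp_id sT'); apply: is_derive_clamp_ext => //.
  exact: ct.
- move=> s x; have := cx _ x (clamp_itv s T0).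
  by move=> /derivableP; rewrite /dx derive1E.
Qed.

(** * The relative entropy and its flux *)

(** The entropy [eta] as a quadratic form in the two components. *)
Definition quad_entropy (R : realType) (a lam p q : R) : R :=
  2^-1 * (lam ^+ 2 * p ^+ 2 - 2 * a * p * q + q ^+ 2).

(** The entropy flux, [1/2 W^T H A W] where [W = (p, q)] and [A] is the matrix
    of the system, with rows [(0, 1)] and [(lam^2, 0)]. *)
Definition quad_flux (R : realType) (a lam p q : R) : R :=
  lam ^+ 2 * (p * q) - 2^-1 * (a * q ^+ 2) - 2^-1 * (a * lam ^+ 2 * p ^+ 2).

Lemma etaE (R : realType) (a lam : R) (U : 'cV[R]_2) :
  Defs.eta a lam U = quad_entropy a lam (U 0 0) (U 1 0).
Proof.
have l0 : lift ord0 ord0 = 1 :> 'I_2 by apply: val_inj.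
rewrite /Defs.eta /quad_entropy; congr (_ * _).
rewrite !mxE !big_ord_recl !big_ord0 !mxE !big_ord_recl !big_ord0 !mxE/= !l0.
by ring.
Qed.

(** [eta] being quadratic, its difference quotient along [V] is the derivative
    plus [h * eta V]. *)
Lemma derive_eta (R : realType) (a lam : R) (U V : 'cV[R]_2) :
  'D_V (Defs.eta a lam) U =
  (lam ^+ 2 * U 0 0 - a * U 1 0) * V 0 0 + (U 1 0 - a * U 0 0) * V 1 0.
Proof.
set l := RHS; rewrite /derive; apply: cvg_lim => //.
have c : {for 0, continuous (fun h : R => l + h * Defs.eta a lam V)}.
  by apply: cvgD; [exact: cvg_cst|apply: cvgM; [exact: cvg_id|exact: cvg_cst]].
rewrite /prop_for /continuous_at mul0r addr0 in c.
have {}c : (l + h * Defs.eta a lam V) @[h --> (0 : R)^'] --> l.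
  exact: cvg_within_filter.
apply: cvg_trans c; apply: near_eq_cvg.
near=> h; have h0 : h != 0 by near: h; exact: nbhs_dnbhs_neq.
rewrite /GRing.scale/= !etaE !mxE /quad_entropy /l.
by field.
Unshelve. all: by end_near. Qed.

Lemma eta_relE (R : realType) (a lam : R) (U V : 'cV[R]_2) :
  eta_rel a lam U V =
  quad_entropy a lam (U 0 0 - V 0 0) (U 1 0 - V 1 0).
Proof.
have l0 : lift ord0 ord0 = 1 :> 'I_2 by apply: val_inj.
rewrite /eta_rel !mxE !big_ord_recl !big_ord0 !mxE/= !derive_eta !mxE/= !l0 !etaE.
by rewrite /quad_entropy/=; field.
Qed.

(** Twice [lam * quad_entropy -/+ quad_flux] is
    [(lam +/- a) * (lam p -/+ q)^2]: one square for each characteristic. *)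
Lemma quad_flux_le (R : realType) (a lam p q : R) : 0 < lam -> `|a| < lam ->
  `|quad_flux a lam p q| <= lam * quad_entropy a lam p q.
Proof.
move=> lam0; rewrite ltr_norml => /andP[a1 a2]; rewrite ler_norml.
have H1 : 0 <= (lam + a) * (lam * p - q) ^+ 2.
  by rewrite mulr_ge0 ?sqr_ge0//; lra.
have H2 : 0 <= (lam - a) * (lam * p + q) ^+ 2.
  by rewrite mulr_ge0 ?sqr_ge0//; lra.
have E1 : lam * quad_entropy a lam p q - quad_flux a lam p q =
    2^-1 * ((lam + a) * (lam * p - q) ^+ 2).
  by rewrite /quad_entropy /quad_flux; field.
have E2 : lam * quad_entropy a lam p q + quad_flux a lam p q =
    2^-1 * ((lam - a) * (lam * p + q) ^+ 2).
  by rewrite /quad_entropy /quad_flux; field.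
by apply/andP; split; lra.
Qed.

Lemma quad_entropy_ge0 (R : realType) (a lam p q : R) :
  0 < lam -> `|a| < lam -> 0 <= quad_entropy a lam p q.
Proof.
move=> lam0 /(quad_flux_le p q lam0) H.
by rewrite -(pmulr_rge0 _ lam0); apply: le_trans H.
Qed.

(** Here [pt, px, qt, qx, g] stand for the values of the partial derivatives of
    [p] and [q] and of [ub_x]; the left-hand side is, by the chain rule,
    [d_t quad_entropy + d_x quad_flux] plus the dissipation.  The gap between
    the two sides is the square
    [(a p - q - eps (lam^2 - a^2) g)^2 / (2 eps)]. *)
Lemma quad_entropy_balance_le (R : realType) (a lam eps p q pt px qt qx g : R) :
  0 < eps -> pt + qx = 0 ->
  qt + lam ^+ 2 * px = eps^-1 * (a * p - q) - (lam ^+ 2 - a ^+ 2) * g ->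
  (lam ^+ 2 * p - a * q) * pt + (q - a * p) * qt
  + ((lam ^+ 2 * q - a * lam ^+ 2 * p) * px + (lam ^+ 2 * p - a * q) * qx)
  + (2 * eps)^-1 * (a * p - q) ^+ 2
  <= eps * (lam ^+ 2 - a ^+ 2) ^+ 2 / 2 * g ^+ 2.
Proof.
move=> eps0 E1 E2.
have -> : pt = - qx by lra.
have -> : qt = eps^-1 * (a * p - q) - (lam ^+ 2 - a ^+ 2) * g - lam ^+ 2 * px.
  by lra.
rewrite -subr_ge0.
have -> : eps * (lam ^+ 2 - a ^+ 2) ^+ 2 / 2 * g ^+ 2 -
  ((lam ^+ 2 * p - a * q) * - qx +
   (q - a * p) * (eps^-1 * (a * p - q) - (lam ^+ 2 - a ^+ 2) * g -
                  lam ^+ 2 * px) +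
   ((lam ^+ 2 * q - a * lam ^+ 2 * p) * px + (lam ^+ 2 * p - a * q) * qx) +
   (2 * eps)^-1 * (a * p - q) ^+ 2) =
  (2 * eps)^-1 * (a * p - q - eps * (lam ^+ 2 - a ^+ 2) * g) ^+ 2.
  by field; rewrite gt_eqF.
by rewrite mulr_ge0 ?sqr_ge0// invr_ge0 mulr_ge0// ltW.
Qed.

Lemma is_derive_quad_entropy (R : realType) (a lam x dp dq : R) (p q : R -> R) :
  is_derive x 1 p dp -> is_derive x 1 q dq ->
  is_derive x 1 (fun y => quad_entropy a lam (p y) (q y))
    ((lam ^+ 2 * p x - a * q x) * dp + (q x - a * p x) * dq).
Proof.
move=> dpx dqx; rewrite /quad_entropy.
by apply: is_derive_eq; rewrite /GRing.scale/=; field.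
Qed.

Lemma is_derive_quad_flux (R : realType) (a lam x dp dq : R) (p q : R -> R) :
  is_derive x 1 p dp -> is_derive x 1 q dq ->
  is_derive x 1 (fun y => quad_flux a lam (p y) (q y))
    ((lam ^+ 2 * q x - a * lam ^+ 2 * p x) * dp
     + (lam ^+ 2 * p x - a * q x) * dq).
Proof.
move=> dpx dqx; rewrite /quad_flux.
by apply: is_derive_eq; rewrite /GRing.scale/=; field.
Qed.

(** * The dissipation estimate *)

(** The estimate with the relative entropy in explicit form, for [t > 0]. *)
Lemma relative_entropy_dissipation (R : realType) (a lambda eps T t : R)
    (u v ub : R -> R -> R) :
  0 < lambda -> 0 < eps -> 0 < T -> `|a| < lambda ->
  jin_xin_solution a lambda eps T u v -> advection_solution a T ub ->
  0 < t -> t <= T ->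
  (\int[lebesgue_measure]_x (quad_entropy a lambda (u t x - ub t x)
       (v t x - a * ub t x))%:E
   + ((2 * eps)^-1)%:E * space_time_int t
       (fun s x => (a * (u s x - ub s x) - (v s x - a * ub s x)) ^+ 2)%R
   <= \int[lebesgue_measure]_x (quad_entropy a lambda (u 0%R x - ub 0%R x)
       (v 0%R x - a * ub 0%R x))%:E
   + (eps * (lambda ^+ 2 - a ^+ 2) ^+ 2 / 2)%:E
     * space_time_int t (fun s x => (dx ub s x) ^+ 2)%R)%E.
Proof.
move=> lam0 eps0 T0 alam [su sv JX] [sub AD] t0 tT.
have T0' := ltW T0.
have [cu cut cux dut dux] := C1_strip T0' su.
have [cv cvt cvx dvt dvx] := C1_strip T0' sv.
have [cb cbt cbx dbt dbx] := C1_strip T0' sub.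
have inT s : s \in `[0, t] -> s \in `[0, T].
  by rewrite !in_itv/= => /andP[-> /le_trans]; apply.
pose c := clamp T.
(* derivatives are frozen along with the functions, so that the pointwise
   relations given by the equations hold on the whole plane *)
pose p s x := u (c s) x - ub (c s) x.
pose q s x := v (c s) x - a * ub (c s) x.
pose pt s x := dt T u (c s) x - dt T ub (c s) x.
pose qt s x := dt T v (c s) x - a * dt T ub (c s) x.
pose px s x := dx u (c s) x - dx ub (c s) x.
pose qx s x := dx v (c s) x - a * dx ub (c s) x.
pose g s x := dx ub (c s) x.
have cp : continuous (fun z : R * R => p z.1 z.2).
  by move=> z; apply: cvgB; [exact: cu|exact: cb].
have cq : continuous (fun z : R * R => q z.1 z.2).
  by move=> z; apply: cvgB; [exact: cv|apply: cvgM; [exact: cvg_cst|exact: cb]].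
have cpt : continuous (fun z : R * R => pt z.1 z.2).
  by move=> z; apply: cvgB; [exact: cut|exact: cbt].
have cqt : continuous (fun z : R * R => qt z.1 z.2).
  by move=> z; apply: cvgB; [exact: cvt|apply: cvgM; [exact: cvg_cst|exact: cbt]].
have cpx : continuous (fun z : R * R => px z.1 z.2).
  by move=> z; apply: cvgB; [exact: cux|exact: cbx].
have cqx : continuous (fun z : R * R => qx z.1 z.2).
  by move=> z; apply: cvgB; [exact: cvx|apply: cvgM; [exact: cvg_cst|exact: cbx]].
have cg : continuous (fun z : R * R => g z.1 z.2) by exact: cbx.
have cZ (k : R) (f : R -> R -> R) : continuous (fun z : R * R => f z.1 z.2) ->
    continuous (fun z : R * R => k * f z.1 z.2).
  by move=> cf z; apply: cvgM; [exact: cvg_cst|exact: cf].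
have dpt (s x : R) : s \in `]0, T[ -> is_derive s 1 (p^~ x) (pt s x).
  move=> sT; have := dut s x sT; have := dbt s x sT => d1 d2.
  by apply: is_derive_eq.
have dqt (s x : R) : s \in `]0, T[ -> is_derive s 1 (q^~ x) (qt s x).
  move=> sT; have := dvt s x sT; have := dbt s x sT => d1 d2.
  by apply: is_derive_eq.
have dpx (s x : R) : is_derive x 1 (p s) (px s x).
  by have := dux s x; have := dbx s x => d1 d2; apply: is_derive_eq.
have dqx (s x : R) : is_derive x 1 (q s) (qx s x).
  by have := dvx s x; have := dbx s x => d1 d2; apply: is_derive_eq.
have keps0 : 0 <= (2 * eps)^-1 by rewrite invr_ge0 mulr_ge0// ltW.
have klam0 : 0 <= eps * (lambda ^+ 2 - a ^+ 2) ^+ 2 / 2.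
  by rewrite divr_ge0// mulr_ge0 ?sqr_ge0// ltW.
pose z2 s x := (a * p s x - q s x) ^+ 2.
pose g2 s x := g s x ^+ 2.
have cz2 : continuous (fun z : R * R => z2 z.1 z.2).
  move=> z; apply: cvg_sqr; apply: cvgB; last exact: cq.
  exact: cZ.
have cg2 : continuous (fun z : R * R => g2 z.1 z.2).
  by move=> z; apply: cvg_sqr; exact: cg.
pose e s x := quad_entropy a lambda (p s x) (q s x).
pose et s x := (lambda ^+ 2 * p s x - a * q s x) * pt s x
               + (q s x - a * p s x) * qt s x.
pose F s x := quad_flux a lambda (p s x) (q s x).
pose Fx s x := (lambda ^+ 2 * q s x - a * lambda ^+ 2 * p s x) * px s x
               + (lambda ^+ 2 * p s x - a * q s x) * qx s x.
have ce : continuous (fun z : R * R => e z.1 z.2).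
  move=> z; apply: cvgM; first exact: cvg_cst.
  apply: cvgD; last by apply: cvg_sqr; exact: cq.
  apply: cvgB.
    by apply: cvgM; [exact: cvg_cst|apply: cvg_sqr; exact: cp].
  by apply: cvgM; [exact: cZ|exact: cq].
have cF : continuous (fun z : R * R => F z.1 z.2).
  move=> z; apply: cvgB; first apply: cvgB.
  - apply: cvgM; first exact: cvg_cst.
    by apply: cvgM; [exact: cp|exact: cq].
  - apply: cvgM; first exact: cvg_cst.
    by apply: cvgM; [exact: cvg_cst|apply: cvg_sqr; exact: cq].
  - apply: cvgM; first exact: cvg_cst.
    by apply: cvgM; [exact: cvg_cst|apply: cvg_sqr; exact: cp].
have cet : continuous (fun z : R * R => et z.1 z.2).
  move=> z; apply: cvgD; apply: cvgM.
  - by apply: cvgB; exact: cZ.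
  - exact: cpt.
  - by apply: cvgB; [exact: cq|exact: cZ].
  - exact: cqt.
have cFx : continuous (fun z : R * R => Fx z.1 z.2).
  move=> z; apply: cvgD; apply: cvgM.
  - by apply: cvgB; exact: cZ.
  - exact: cpx.
  - by apply: cvgB; exact: cZ.
  - exact: cqx.
have e0 s x : 0 <= e s x by exact: quad_entropy_ge0.
have D0 s x : 0 <= (2 * eps)^-1 * z2 s x by rewrite mulr_ge0// sqr_ge0.
have S0 s x : 0 <= eps * (lambda ^+ 2 - a ^+ 2) ^+ 2 / 2 * g2 s x.
  by rewrite mulr_ge0// sqr_ge0.
have de (s x : R) : s \in `]0, t[ -> is_derive s 1 (e^~ x) (et s x).
  rewrite in_itv/= => /andP[s0 st].
  have sT : s \in `]0, T[ by rewrite in_itv/= s0 (lt_le_trans st).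
  exact: (is_derive_quad_entropy a lambda (dpt s x sT) (dqt s x sT)).
have dF (s x : R) : s \in `[0, t] -> is_derive x 1 (F s) (Fx s x).
  by move=> _; exact: (is_derive_quad_flux a lambda (dpx s x) (dqx s x)).
have Fe s x : `|F s x| <= lambda * e s x by exact: quad_flux_le.
have balance (s x : R) : s \in `[0, t] ->
    et s x + Fx s x + (2 * eps)^-1 * z2 s x
    <= eps * (lambda ^+ 2 - a ^+ 2) ^+ 2 / 2 * g2 s x.
  move=> _; have csT := clamp_itv s T0'.
  have [JX1 JX2] := JX (c s) x csT.
  have AD1 := AD (c s) x csT.
  apply: quad_entropy_balance_le => //.
    by rewrite /pt /qx; lra.
  rewrite /qt /px /p /q /g.
  have -> : dt T ub (c s) x = - (a * dx ub (c s) x) by lra.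
  have -> : dt T v (c s) x = eps^-1 * (a * u (c s) x - v (c s) x)
      - lambda ^+ 2 * dx u (c s) x by lra.
  by ring.
have H := @finite_speed_integral_le R lambda t e et F Fx
  (fun s x => (2 * eps)^-1 * z2 s x)
  (fun s x => eps * (lambda ^+ 2 - a ^+ 2) ^+ 2 / 2 * g2 s x) lam0 t0
  ce cet cF cFx (cZ _ _ cz2) (cZ _ _ cg2) e0 D0 S0 de dF Fe balance.
have Ez := integral2Zl (fun s x => sqr_ge0 (a * p s x - q s x)) cz2 t keps0.
have Eg := integral2Zl (fun s x => sqr_ge0 (g s x)) cg2 t klam0.
have cE s : s \in `[0, t] -> c s = s by move=> /inT; exact: clamp_id.
have tE : c t = t by apply: cE; rewrite in_itv/= lexx ltW.
have oE : c 0 = 0 by apply: cE; rewrite in_itv/= lexx ltW.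
have intE (f : R -> R -> R) :
    (\int[lebesgue_measure]_(s in `[0%R, t])
       \int[lebesgue_measure]_x (f (c s) x)%:E
     = \int[lebesgue_measure]_(s in `[0%R, t])
       \int[lebesgue_measure]_x (f s x)%:E)%E.
  by apply: eq_integral => s; rewrite inE/= => /cE ->.
have Iz := intE (fun s x => (a * (u s x - ub s x) - (v s x - a * ub s x)) ^+ 2).
have Ig := intE (fun s x => dx ub s x ^+ 2).
rewrite /space_time_int -Iz -Ig.
have -> : (\int[lebesgue_measure]_x (quad_entropy a lambda (u t x - ub t x)
     (v t x - a * ub t x))%:E = \int[lebesgue_measure]_x (e t x)%:E)%E.
  by rewrite /e /p /q tE.
have -> : (\int[lebesgue_measure]_x (quad_entropy a lambda (u 0%R x - ub 0%R x)
     (v 0%R x - a * ub 0%R x))%:E = \int[lebesgue_measure]_x (e 0%R x)%:E)%E.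
  by rewrite /e /p /q oE.
rewrite -[X in (_ + X <= _)%E]Ez -[X in (_ <= _ + X)%E]Eg.
exact: H.
Qed.

Theorem proposition2 (R : realType) (a lambda eps T : R)
    (u v ub : R -> R -> R) (Um Up : 'cV[R]_2) (K : R) :
  let vb := fun t x : R => a * ub t x in
  let U := fun t x : R => vec2 (u t x) (v t x) in
  let Ub := fun t x : R => vec2 (ub t x) (vb t x) in
  0 < lambda -> 0 < eps -> 0 < T ->
  jin_xin_solution a lambda eps T u v ->
  advection_solution a T ub ->
  `|a| < lambda ->
  Meq a Um -> Meq a Up ->
  (forall t : R, t \in `[0, T] ->
    [/\ U t x @[x --> -oo] --> Um, Ub t x @[x --> -oo] --> Um,
        U t x @[x --> +oo] --> Up & Ub t x @[x --> +oo] --> Up]) ->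
  0 < K ->
  (forall t : R, t \in `[0, T] ->
    (space_time_int t (fun s x => `|dx ub s x| ^+ 2)%R <= (K ^+ 2)%:E)%E) ->
  forall t : R, t \in `[0, T] ->
    (Phi a lambda U Ub t
       + ((2 * eps)^-1)%:E
         * space_time_int t
             (fun s x => (a * (u s x - ub s x) - (v s x - vb s x)) ^+ 2)%R
     <= Phi a lambda U Ub 0
       + (eps * (lambda ^+ 2 - a ^+ 2) ^+ 2 / 2)%:E
         * space_time_int t (fun s x => `|dx ub s x| ^+ 2)%R)%E /\
    (Phi a lambda U Ub t
     <= Phi a lambda U Ub 0
       + (eps * (lambda ^+ 2 - a ^+ 2) ^+ 2 / 2 * K ^+ 2)%:E)%E.
Proof.
move=> vb U Ub lam0 eps0 T0 JX AD alam _ _ _ _ intK t tT.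
have PhiE s : Phi a lambda U Ub s =
    (\int[lebesgue_measure]_x (quad_entropy a lambda (u s x - ub s x)
       (v s x - a * ub s x))%:E)%E.
  by apply: eq_integral => x _; rewrite eta_relE !mxE.
have st_ge0 (f : R -> R -> R) : (forall s x, 0 <= f s x) ->
    (0 <= space_time_int t f)%E.
  move=> f0; apply: integral_ge0 => s _; apply: integral_ge0 => x _.
  by rewrite lee_fin.
have k0 : 0 <= eps * (lambda ^+ 2 - a ^+ 2) ^+ 2 / 2.
  by rewrite divr_ge0// mulr_ge0 ?sqr_ge0// ltW.
have main : (Phi a lambda U Ub t
       + ((2 * eps)^-1)%:E
         * space_time_int t
             (fun s x => (a * (u s x - ub s x) - (v s x - vb s x)) ^+ 2)%R
     <= Phi a lambda U Ub 0
       + (eps * (lambda ^+ 2 - a ^+ 2) ^+ 2 / 2)%:E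
         * space_time_int t (fun s x => `|dx ub s x| ^+ 2)%R)%E.
  have -> : (fun s x => `|dx ub s x| ^+ 2) = (fun s x => dx ub s x ^+ 2).
    by apply/funext => s; apply/funext => x; rewrite real_normK ?num_real.
  move: tT; rewrite in_itv/= => /andP[]; rewrite le_eqVlt => /predU1P[<- _|t0 tT].
    (* at [t = 0] the space-time integrals run over a null set of times *)
    by rewrite /space_time_int !set_itv1 !integral_set1 !mule0.
  rewrite !PhiE; exact: (relative_entropy_dissipation lam0 eps0 T0 alam JX AD t0 tT).
split; first exact: main.
apply: (le_trans (le_trans _ main)).
  rewrite leeDl// mule_ge0//; last first.
    by apply: st_ge0 => s x; exact: sqr_ge0.
  by rewrite lee_fin invr_ge0 mulr_ge0// ltW.
by rewrite leeD2l// [leRHS]EFinM lee_wpmul2l// ?lee_fin// intK.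
Qed.
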